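(* Let $n\geq 6$ and let $U_n$ be the set of $C_4$-free unicyclic graphs of order $n$. Let $G_1,G_2,G_3\in U_n$ be the graphs of order $n$ defined in the context. Then for any $G\in U_n$ that is not isomorphic to any of $G_1,G_2,G_3$, we have $$q(G)<q(G_{3})<q(G_{2})<q(G_{1}).$$
   Context: All graphs are finite and simple. A unicyclic graph of order $n$ is a connected graph with $n$ vertices and $n$ edges. A graph is $C_4$-free if it has no (not necessarily induced) subgraph isomorphic to the cycle $C_4$ on 4 vertices. For a graph $G$ with adjacency matrix $A(G)$ and diagonal matrix of vertex degrees $D(G)$, $Q(G)=D(G)+A(G)$ is the signless Laplacian matrix and $q(G)$ denotes its largest eigenvalue. The graphs, each of order $n$, are: - $G_1=K_1\vee(K_2\cup(n-3)K_1)$: a triangle with $n-3$ pendant vertices attached to one of its vertices. - $G_2$: a triangle $w,a,b$ with $n-4$ pendant vertices attached to $w$ and one pendant vertex attached to $a$. - $G_3$: a triangle $w,a,b$ with $n-5$ pendant vertices attached to $w$, and a pendant path of length 2 attached at $w$ (a vertex $c$ adjacent to $w$, and a vertex $z$ adjacent only to $c$). *)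

(* Defs.v *)
From mathcomp Require Import all_boot all_order all_algebra.
From mathcomp Require Import classical_sets reals.
From mathcomp Require Import complex polyrcf.

Set Implicit Arguments.
Unset Strict Implicit.
Unset Printing Implicit Defensive.

Import Order.TTheory GRing.Theory Num.Theory.

Declare Scope sgraph_scope.
Delimit Scope sgraph_scope with sg.

Record sgraph := SGraph {
  vertex :> finType;
  adj : rel vertex;
  adj_sym : symmetric adj;
  adj_irr : irreflexive adj }.

Notation "x -- y" := (adj x y) (at level 30, no associativity) : sgraph_scope.
Open Scope sgraph_scope.

Definition edge_set (G : sgraph) : {set {set G}} :=
  [set [set x; y] | x in G, y in G & x -- y].

Definition deg (G : sgraph) (x : G) : nat := #|[set y | x -- y]|.

Definition connected (G : sgraph) : Prop :=
  (0 < #|G|)%N /\ forall x y : G, connect (@adj G) x y.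

Definition isomorphic (G H : sgraph) : Prop :=
  exists2 f : G -> H, bijective f & forall x y, (f x -- f y) = (x -- y).

(* [H] is isomorphic to a (not necessarily induced) subgraph of [G]. *)
Definition subgraph_of (H G : sgraph) : Prop :=
  exists2 f : H -> G, injective f & forall x y, x -- y -> f x -- f y.

(* The simple graph whose edges are the pairs {x, y}, x != y, with [r x y] or
   [r y x]; this allows [r] to list each edge in one direction only. *)
Section GraphOf.
Variables (T : finType) (r : rel T).

Definition graph_of_adj : rel T := [rel x y | (x != y) && (r x y || r y x)].

Fact graph_of_sym : symmetric graph_of_adj.
Proof. by move=> x y; rewrite /graph_of_adj /= eq_sym orbC. Qed.

Fact graph_of_irr : irreflexive graph_of_adj.
Proof. by move=> x; rewrite /graph_of_adj /= eqxx. Qed.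

Definition graph_of : sgraph := SGraph graph_of_sym graph_of_irr.
End GraphOf.

Definition cycle_graph (k : nat) : sgraph :=
  graph_of [rel i j : 'I_k | j == i.+1 %% k :> nat].

Definition C4_free (G : sgraph) : Prop := ~ subgraph_of (cycle_graph 4) G.

Definition unicyclic (n : nat) (G : sgraph) : Prop :=
  [/\ connected G, #|G| = n & #|edge_set G| = n].

Definition U (n : nat) (G : sgraph) : Prop := unicyclic n G /\ C4_free G.

(* In the next three graphs w = 0, a = 1, b = 2 is the triangle. *)

Definition G1 (n : nat) : sgraph :=
  graph_of [rel i j : 'I_n |
    (i == 0 :> nat) || (i == 1 :> nat) && (j == 2 :> nat)].

(* 3 is the pendant vertex at a; 4, ..., n-1 are the pendant vertices at w. *)
Definition G2 (n : nat) : sgraph :=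
  graph_of [rel i j : 'I_n |
    [|| (i == 0 :> nat) && (j != 3 :> nat),
        (i == 1 :> nat) && (j == 2 :> nat)
      | (i == 1 :> nat) && (j == 3 :> nat)]].

(* c = 3, z = 4; 5, ..., n-1 are the pendant vertices at w. *)
Definition G3 (n : nat) : sgraph :=
  graph_of [rel i j : 'I_n |
    [|| (i == 0 :> nat) && (j != 4 :> nat),
        (i == 1 :> nat) && (j == 2 :> nat)
      | (i == 3 :> nat) && (j == 4 :> nat)]].

Local Open Scope ring_scope.

(* Matrices are indexed by the vertices through [enum_val]. *)
Section SignlessLaplacian.
Variables (R : realType) (G : sgraph).

Definition adjacency_mx : 'M[R]_#|G| :=
  \matrix_(i, j) (enum_val i -- enum_val j)%:R.

Definition degree_mx : 'M[R]_#|G| :=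
  diag_mx (\row_i (deg (enum_val i))%:R).

Definition signless_laplacian : 'M[R]_#|G| := degree_mx + adjacency_mx.

(* The set is finite, and nonempty if G is, so this supremum is a maximum: see
   [q_largest]. *)
Definition q : R := sup [set a | eigenvalue signless_laplacian a]%classic.

Lemma signless_laplacian_sym : signless_laplacian^T = signless_laplacian.
Proof.
rewrite /signless_laplacian linearD /= tr_diag_mx; congr (_ + _).
by apply/matrixP => i j; rewrite !mxE adj_sym.
Qed.
End SignlessLaplacian.

Lemma sym_has_eigenvalue (R : realType) (n : nat) (A : 'M[R]_n) :
  (0 < n)%N -> A^T = A -> exists a, eigenvalue A a.
Proof.
move=> n0 symA; pose toC := real_complex R.
have : size (char_poly (map_mx toC A)) != 1%N.
  by rewrite size_char_poly eqSS -lt0n.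
case/closed_rootP => c; rewrite -eigenvalue_root_char => /eigenvalueP[v vA v0].
pose w := map_mx conjc v.
have wA : w *m map_mx toC A = conjc c *: w.
  rewrite -[conjc c *: w]map_mxZ /= -vA map_mxM; congr (_ *m _).
  by apply/matrixP => i j; rewrite !mxE; exact/esym/conjc_real.
have symC : (map_mx toC A)^T = map_mx toC A by rewrite map_trmx symA.
have eqc : c *: (v *m w^T) = conjc c *: (v *m w^T).
  rewrite scalemxAl -vA -mulmxA scalemxAr.
  by rewrite -linearZ /= -wA trmx_mul symC.
have vw0 : (v *m w^T) 0 0 != 0.
  rewrite mxE; apply: contra v0 => /eqP s0; apply/eqP/rowP => i; rewrite mxE.
  have /psumr_eq0P : forall j : 'I_n, true -> 0 <= v 0 j * w^T j 0.
    by move=> j _; rewrite !mxE mulcJ_ge0.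
  move=> /(_ s0 i isT) /eqP; rewrite !mxE mulf_eq0 conjc_eq0 orbb.
  by move/eqP.
have cc : conjc c = c.
  by move/matrixP/(_ 0 0): eqc; rewrite mxE [RHS]mxE => /(mulIf vw0) <-.
exists (complex.Re c).
have <- : eigenvalue (map_mx toC A) (toC (complex.Re c)) =
  eigenvalue A (complex.Re c) by rewrite eigenvalue_map.
apply/eigenvalueP; exists v => //; rewrite vA; congr (_ *: _).
case: c {vA wA eqc} cc => x y [] /eqP; rewrite eq_sym -addr_eq0 -mulr2n mulrn_eq0 /=.
by move/eqP->.
Qed.

Lemma q_largest (R : realType) (G : sgraph) : (0 < #|G|)%N ->
  eigenvalue (signless_laplacian R G) (q R G) /\
  forall a, eigenvalue (signless_laplacian R G) a -> a <= q R G.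
Proof.
move=> G0; rewrite /q; set A := signless_laplacian R G.
have [a0 a0P] := sym_has_eigenvalue G0 (signless_laplacian_sym R G).
have p0 : char_poly A != 0 by apply: monic_neq0; exact: char_poly_monic.
pose s := rootsR (char_poly A).
have inS a : eigenvalue A a = (a \in s).
  by have /(_ a) := roots_on_rootsR p0; rewrite /= -eigenvalue_root_char.
pose m := \big[Num.max/a0]_(a <- s) a.
have le_m a : eigenvalue A a -> a <= m.
  by rewrite inS /m => sa; apply: le_bigmax_seq sa _.
have mP : eigenvalue A m.
  rewrite /m big_seq; elim/big_ind: _ => //.
    by move=> x y Hx Hy; rewrite /Num.max; case: ifP.
  by move=> a; rewrite inS.
have -> : sup [set a | eigenvalue A a]%classic = m; last by [].
apply/eqP; rewrite eq_le; apply/andP; split.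
  by apply: ge_sup; [exists m | move=> a /le_m].
by apply: ub_le_sup => //; exists m => a /le_m.
Qed.

(* Main.v *)
Require Import Defs.
From mathcomp Require Import all_boot all_order all_algebra.
From mathcomp Require Import complex spectral sesquilinear perm.
From mathcomp Require Import zify ring lra.
From mathcomp Require Import reals.

(** Write [Q x u = \sum_(v ~ u) (x u + x v)].  A breadth-first search tree
    rooted at [w] contains no edge between two neighbours of [w], so at most one
    edge of a unicyclic graph joins neighbours of [w].  Hence a vertex of degree
    at least [n - 2] in a [C4]-free unicyclic graph forces [G1], [G2] or [G3].
    Otherwise all degrees are at most [n - 3]; as the degrees of the neighbours
    of [u] sum to at most [n + 1], weighting each vertex by its degree gives
    [q G <= max_u (d_u + m_u)], where [m_u] is the average degree of the
    neighbours of [u], and this is at most [n - 1] (or [16/3] for [n = 6]).  A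
    test vector shows that [q G3] is larger.  Finally [G2] is obtained from [G3],
    and [G1] from [G2], by moving one pendant edge to a vertex at which an
    eigenvector is larger in modulus, which increases the Rayleigh quotient. *)

Set Implicit Arguments.
Unset Strict Implicit.
Unset Printing Implicit Defensive.

Import Order.TTheory GRing.Theory Num.Theory.

(** * Unicyclic graphs without 4-cycles *)

Lemma set2_eqE (T : finType) (x y a b : T) : x != y ->
  ([set x; y] == [set a; b]) = (x == a) && (y == b) || (x == b) && (y == a).
Proof.
move=> xy; apply/eqP/idP => [/setP E|]; last first.
  by case/orP=> /andP[/eqP-> /eqP->] //; rewrite setUC.
have := E x; have := E y; rewrite !inE !eqxx orbT => /esym ya /esym xa.
by case/orP: xa ya xy => /eqP-> /orP[] /eqP->; rewrite !eqxx ?orbT.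
Qed.

Lemma mem_edge_set (G : sgraph) (x y : G) : ([set x; y] \in edge_set G) = (x -- y).
Proof.
apply/imset2P/idP => [[a b _]|xy]; last by exists x y => //; rewrite inE.
rewrite inE => /andP[_ ab] E; have xa : x \in [set a; b] by rewrite -E set21.
have yb : y \in [set a; b] by rewrite -E set22.
have ba : b -- a by rewrite adj_sym.
have nab : a != b by apply: contraTneq ab => ->; rewrite adj_irr.
have : a \in [set x; y] by rewrite E set21.
have : b \in [set x; y] by rewrite E set22.
move: xa yb; rewrite !inE => /orP[]/eqP-> /orP[]/eqP-> //; rewrite orbb.
  by rewrite eq_sym (negbTE nab).
by move=> _; rewrite orbb (negbTE nab).
Qed.

Lemma edge_setP (G : sgraph) (e : {set G}) :
  reflect (exists x y, e = [set x; y] /\ x -- y) (e \in edge_set G).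
Proof.
apply: (iffP imset2P) => [[x y _]|[x [y [-> xy]]]]; last by exists x y => //; rewrite inE.
by rewrite inE => /andP[_ xy] ->; exists x, y.
Qed.

Lemma adj_neq (G : sgraph) (x y : G) : x -- y -> x != y.
Proof. by apply: contraTneq => ->; rewrite adj_irr. Qed.

(** If [x] and [y] differed, then [u], [x], [v], [y], in this cyclic order, would be a 4-cycle. *)
Lemma C4_free_codeg (G : sgraph) (u v x y : G) : C4_free G ->
  u != v -> u -- x -> u -- y -> v -- x -> v -- y -> x = y.
Proof.
move=> GC uv ux uy vx vy; apply/eqP/negPn/negP => xy; apply: GC.
have s_uniq : uniq [:: u; x; v; y].
  rewrite /= !inE !negb_or uv xy !adj_neq //; first by rewrite adj_sym.
exists (fun i : 'I_4 => nth u [:: u; x; v; y] i).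
  by move=> i j /eqP; rewrite nth_uniq // => /eqP/val_inj.
by move=> [[|[|[|[|i]]]] //= Hi] [[|[|[|[|j]]]] //= Hj]; rewrite adj_sym.
Qed.

(* [h] is the distance to [w] and [p] maps a vertex to its parent in a
   breadth-first search tree rooted at [w]. *)
Lemma bfs_parent (G : sgraph) (w : G) : connected G ->
  exists h p, [/\ forall v, w -- v -> h v = 1,
    forall v, v != w -> v -- p v & forall v, v != w -> h v = (h (p v)).+1].
Proof.
move=> [_ Gc].
(* Encoding walks of length [k] as tuples makes [walk] a boolean predicate, so that [ex_minn] yields
   the distance [h v]. *)
pose walk v k := [exists t : k.-tuple G, path (@adj G) w t && (last w t == v)].
have walkP v k : reflect
    (exists t, [/\ size t = k, path (@adj G) w t & last w t = v]) (walk v k).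
  apply: (iffP existsP) => [[t /andP[tp /eqP tl]]|[t [/eqP ts tp tl]]].
    by exists t; rewrite size_tuple.
  by exists (Tuple ts); rewrite /= tp tl eqxx.
have ex_walk v : exists k, walk v k.
  have /connectP[t tp tl] := Gc w v.
  by exists (size t); apply/walkP; exists t; rewrite tl.
pose h v := ex_minn (ex_walk v).
have h_walk v : walk v (h v) by rewrite /h; case: ex_minnP.
have h_min v k : walk v k -> h v <= k by rewrite /h; case: ex_minnP => m _; apply.
have h0 v : h v = 0 -> v = w.
  move=> hv; have /walkP[t [ts _ <-]] := h_walk v.
  by move: ts; rewrite hv; case: t.
have h_adj u v : u -- v -> h v <= (h u).+1.
  move=> uv; have /walkP[t [ts tp tl]] := h_walk u.
  apply: h_min; apply/walkP; exists (rcons t v).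
  by rewrite size_rcons ts rcons_path tp tl last_rcons.
have hw : h w = 0 by apply/eqP; rewrite -leqn0; apply: h_min; apply/walkP; exists [::].
(* The implication stands inside the existential so that [fin_all_exists] gives a total map [p]; its
   value at [w] is arbitrary. *)
have parent v : exists u, v != w -> v -- u /\ h v = (h u).+1.
  have [->|vw] := eqVneq v w; first by exists w.
  have /walkP[t [ts tp tl]] := h_walk v.
  case/lastP: t ts tp tl => [|t x] ts.
    by move=> _ vE; rewrite -vE eqxx in vw.
  rewrite rcons_path last_rcons => /andP[tp lx] xv; exists (last w t) => _.
  rewrite -xv adj_sym lx xv; split=> //.
  apply/eqP; rewrite eqn_leq h_adj -?xv //= xv -ts size_rcons ltnS.
  by apply: h_min; apply/walkP; exists t.
have [p pP] := fin_all_exists parent.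
exists h, p; split=> v; last 2 first.
- by move=> /pP[].
- by move=> /pP[].
move=> wv; apply/eqP; rewrite eqn_leq -{1}hw h_adj //= lt0n.
by apply: contraTneq wv => /h0 ->; rewrite adj_irr.
Qed.

(** The tree edges [[set v; p v]] with [v != w] are pairwise distinct, so there are [#|G| - 1] of
    them. Each joins two consecutive levels, whereas an edge between neighbours of [w] stays inside
    level 1, so the two families are disjoint. *)
Lemma card_edges_in_nbhd (G : sgraph) (w : G) : connected G ->
  #|[set e in edge_set G | e \subset [set v | w -- v]]| + #|G| <= #|edge_set G|.+1.
Proof.
move=> Gc; have [h [p [h1 pP hP]]] := bfs_parent w Gc.
set E1 := [set e in _ | _]; pose F v := [set v; p v].
have F_inj : {in [set~ w] &, injective F}.
  move=> x y; rewrite !inE => xw yw /eqP; rewrite set2_eqE; last exact/adj_neq/pP.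
  case/orP => /andP[/eqP // xE /eqP yE].
  by have := hP x xw; have := hP y yw; rewrite {1}yE -xE; lia.
have -> : #|G| = #|F @: [set~ w]|.+1.
  by rewrite card_in_imset // cardsC1 prednK //; case: Gc.
rewrite addnS ltnS -cardsUI.
have -> : E1 :&: F @: [set~ w] = set0.
  apply/setP => e; rewrite in_set0; apply/negP; rewrite !inE => /andP[/andP[_ /subsetP eN]].
  case/imsetP => v; rewrite !inE => vw eE.
  have := h1 v; have := h1 (p v); have := hP v vw.
  have := eN v; have := eN (p v); rewrite !inE eE set21 set22.
  by move=> -> // -> // -> /(_ isT) -> /(_ isT).
rewrite cards0 addn0; apply/subset_leq_card/subsetP => e; rewrite !inE.
case/orP=> [/andP[]//|/imsetP[v]]; rewrite !inE => vw ->.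
by rewrite mem_edge_set pP.
Qed.

(** Every edge is [[set v; p v]] for some [v != w], which leaves at most [#|G| - 1] edges. In a
    unicyclic graph this forces some edge to escape any such [p]. *)
Lemma card_edges_parent (G : sgraph) (w : G) (p : G -> G) :
  (forall x y, x -- y -> (x != w) && (y == p x) || (y != w) && (x == p y)) ->
  #|edge_set G| < #|G|.
Proof.
move=> pP; have -> : #|G| = #|[set~ w]|.+1.
  by rewrite cardsC1 prednK //; apply/card_gt0P; exists w.
rewrite ltnS; apply: leq_trans (leq_imset_card (fun v => [set v; p v]) _).
apply/subset_leq_card/subsetP => _ /edge_setP[x [y [-> /pP]]].
case/orP=> /andP[vw /eqP E]; apply/imsetP.
  by exists x; rewrite ?inE // E.
by exists y; rewrite ?inE // E setUC.
Qed.

Lemma codeg_le1 (G : sgraph) (u x : G) : C4_free G -> u != x ->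
  #|[set v | (u -- v) && (v -- x)]| <= 1.
Proof.
move=> GC ux; apply/card_le1_eqP => a b; rewrite !inE => /andP[ua ax] /andP[ub bx].
by apply: (C4_free_codeg GC ux); rewrite // adj_sym.
Qed.

(** Double counting of the walks [u -- v -- x]. The endpoint [x = u] contributes [deg u]. Every
    other [x] contributes at most 1 since there is no 4-cycle, and a neighbour of [u] contributes
    only if it lies on the at most one edge inside the neighbourhood. The total is at most
    [deg u + (n - deg u - 1) + 2]. *)
Lemma sum_deg_nbhd (G : sgraph) (n : nat) (u : G) : U n G ->
  \sum_(v | u -- v) deg v <= n.+1.
Proof.
move=> [[Gc Gn Ge] GC].
have degE v : deg v = \sum_x (v -- x).
  by rewrite /deg -sum1_card big_mkcond; apply: eq_bigr => x _; rewrite inE; case: adj.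
under eq_bigr do rewrite degE.
rewrite exchange_big /= (bigD1 u) //=.
have codegE x : \sum_(v | u -- v) (v -- x) = #|[set v | (u -- v) && (v -- x)]|.
  rewrite -sum1_card big_mkcond [RHS]big_mkcond; apply: eq_bigr => v _.
  by rewrite inE; do 2 case: adj.
set N := [set v | u -- v]; set E1 := [set e in edge_set G | e \subset N].
have E1_le : #|E1| <= 1.
  by have := card_edges_in_nbhd u Gc; rewrite -/N -/E1 Ge Gn; lia.
have cov_le : #|cover E1| <= 2.
  apply: leq_trans (leq_card_cover _) _; apply: (@leq_trans (\sum_(e in E1) 2)).
    apply: leq_sum => e; rewrite inE => /andP[/edge_setP[x [y [-> _]]] _].
    by rewrite cards2; case: (_ != _).
  by rewrite sum_nat_const; lia.
(* If [x] is a neighbour of [u] and [v] is a common neighbour, the edge [[set v; x]] belongs to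
   [E1], hence [x] is covered. *)
have codeg_le x : x != u -> \sum_(v | u -- v) (v -- x) <= (x \in ~: N :|: cover E1).
  move=> xu; rewrite codegE.
  case: (boolP (x \in _)) => [_|]; first by apply: codeg_le1 => //; rewrite eq_sym.
  rewrite !inE negb_or negbK => /andP[ux /negP xE]; rewrite leqn0 cards_eq0.
  apply/eqP/setP => v; rewrite !inE; apply/negP => /andP[uv vx]; apply: xE.
  apply/bigcupP; exists [set v; x]; last by rewrite set22.
  by rewrite inE mem_edge_set vx; apply/subsetP => y; rewrite !inE => /orP[]/eqP->.
have -> : \sum_(v | u -- v) (v -- u) = #|N|.
  by rewrite codegE; apply: eq_card => v; rewrite !inE [v -- u]adj_sym andbb.
apply: (@leq_trans (#|N| + \sum_(x | x != u) (x \in ~: N :|: cover E1))).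
  by rewrite leq_add2l; apply: leq_sum.
have uN : u \in ~: N by rewrite !inE adj_irr.
have -> : \sum_(x | x != u) (x \in ~: N :|: cover E1) = #|~: N :|: cover E1|.-1.
  rewrite -sum1_card [in RHS](bigD1 u) /=; last by rewrite in_setU uN.
  rewrite [LHS]big_mkcond [RHS]big_mkcond; apply: eq_bigr => x _.
  by case: (_ \in _ :|: _); case: (_ != _).
have := cardsU (~: N) (cover E1); have := cardsC N; rewrite Gn.
have : 0 < #|~: N| by apply/card_gt0P; exists u.
lia.
Qed.

(** Puts the distinguished vertices [s] at the labels [0, 1, ...] and the others anywhere after
    them. The conclusion is a boolean equation so that it rewrites the label tests in [G1], [G2] and
    [G3]. *)
Lemma numbering (G : sgraph) (s : seq G) (n : nat) : #|G| = n -> uniq s ->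
  exists2 f : G -> 'I_n, bijective f &
    forall i x, i < size s -> (f x == i :> nat) = (x == nth x s i).
Proof.
move=> Gn us; pose t := s ++ [seq x <- enum G | x \notin s].
have ut : uniq t.
  rewrite cat_uniq us filter_uniq ?enum_uniq // andbT /=.
  by apply/hasPn => x; rewrite mem_filter => /andP[].
have mt x : x \in t by rewrite mem_cat mem_filter mem_enum andbT orbN.
have st : size t = n.
  by rewrite -Gn -(card_uniqP ut); apply: eq_card => x; rewrite mt.
have lt_n x : index x t < n by rewrite -st index_mem.
exists (fun x => Ordinal (lt_n x)).
  apply: inj_card_bij; last by rewrite card_ord Gn.
  by move=> x y [] /(congr1 (nth x t)); rewrite !nth_index.
move=> i x si /=; have it : i < size t by rewrite size_cat ltn_addr.
have -> : nth x s i = nth x t i by rewrite nth_cat si.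
by apply/eqP/eqP => [<-|->]; rewrite ?nth_index ?index_uniq.
Qed.

Lemma isomorphic_graph_of (G : sgraph) (n : nat) (r : rel 'I_n) (f : G -> 'I_n) :
  bijective f -> (forall x y, (x -- y) = (x != y) && (r (f x) (f y) || r (f y) (f x))) ->
  isomorphic G (graph_of r).
Proof.
by move=> fB adjE; exists f => // x y; rewrite adjE /= /graph_of_adj /= (bij_eq fB).
Qed.

(* A vertex [w] adjacent to all vertices but at most one dominates a star with
   at least [n-2] edges, which leaves room for one triangle through [w] and for
   the edge at the vertex that [w] misses. *)
Lemma large_deg_isomorphic (G : sgraph) (n : nat) (w : G) : 3 < n -> U n G ->
  n - 2 <= deg w ->
  [\/ isomorphic G (G1 n), isomorphic G (G2 n) | isomorphic G (G3 n)].
Proof.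
move=> n3 [[Gc Gn Ge] GC] dw.
set N := [set v | w -- v]; set E1 := [set e in edge_set G | e \subset N].
have E1_le : #|E1| <= 1.
  by have := card_edges_in_nbhd w Gc; rewrite -/N -/E1 Ge Gn; lia.
(* If the edges outside the neighbourhood [N] all come from a parent map [p], counting edges forces
   an edge [ab] inside [N]; by [E1_le] it is the only one. *)
have tri (p : G -> G) :
    (forall x y, x -- y -> ~~ ((w -- x) && (w -- y)) ->
       (x != w) && (y == p x) || (y != w) && (x == p y)) ->
  exists a b, [/\ w -- a, w -- b, a != b & forall x y, w -- x -> w -- y ->
     (x -- y) = (x == a) && (y == b) || (x == b) && (y == a)].
  move=> pP; have /existsP[e eE1] : [exists e, e \in E1].
    apply/contraT => /existsPn E10.
    have := @card_edges_parent G w p; rewrite Ge Gn ltnn; apply=> x y xy.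
    apply: pP => //; apply: contra (E10 [set x; y]) => /andP[wx wy].
    by rewrite inE mem_edge_set xy; apply/subsetP => v; rewrite !inE => /orP[]/eqP->.
  have := eE1; rewrite inE => /andP[/edge_setP[a [b [eE ab]]] /subsetP eN].
  have wa : w -- a by have := eN a; rewrite eE set21 inE; apply.
  have wb : w -- b by have := eN b; rewrite eE set22 inE; apply.
  exists a, b; split=> // [|x y wx wy]; first exact: adj_neq.
  have [<-|xy] := eqVneq x y.
    rewrite adj_irr; apply/esym/negP => /orP[]/andP[/eqP-> /eqP E];
    by move: ab; rewrite E adj_irr.
  rewrite -set2_eqE //; apply/idP/eqP => [xyE|E].
    have /card_le1_eqP := E1_le; rewrite -eE; apply => //.
    by rewrite inE mem_edge_set xyE; apply/subsetP => v; rewrite !inE => /orP[]/eqP->.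
  by rewrite -mem_edge_set E mem_edge_set.
have NC : #|~: (w |: N)| <= 1.
  have := cardsC (w |: N); rewrite cardsU1 !inE adj_irr Gn /=.
  by move: dw; rewrite /deg -/N; lia.
have [/existsP[z]|/existsPn Nall] := boolP [exists z, z \in ~: (w |: N)]; last first.
  have wall x : (w -- x) = (x != w).
    apply/idP/idP => [/adj_neq|xw]; first by rewrite eq_sym.
    by have := Nall x; rewrite !inE negbK (negbTE xw).
  (* Here [w] is adjacent to every other vertex, so an edge outside [N] has [w] as an end. *)
  have [|a [b [wa wb ab abP]]] := tri (fun=> w).
    move=> x y /adj_neq xy; rewrite !wall negb_and !negbK => /orP[]/eqP E; subst.
      by rewrite eqxx andbT eq_sym xy orbT.
    by rewrite eqxx andbT xy.
  constructor 1; have [|f fB fE] := @numbering G [:: w; a; b] n Gn.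
    by rewrite /= !inE negb_or ab !adj_neq.
  apply: (isomorphic_graph_of fB) => x y /=.
  rewrite !(fE 0) // !(fE 1) // !(fE 2) //=.
  have [->|xw] := eqVneq x w; first by rewrite wall eq_sym andbT.
  have [->|yw] := eqVneq y w; first by rewrite adj_sym wall xw orbT.
  rewrite abP ?wall //=.
  have [<-|xy] := eqVneq x y; last by congr (_ || _); rewrite andbC.
  apply/negP => /orP[]/andP[/eqP xa /eqP xb];
  by move: ab; rewrite -xa -xb eqxx.
rewrite !inE negb_or => /andP[zw wz].
have wadj x : (w -- x) = (x != w) && (x != z).
  apply/idP/idP => [wx|/andP[xw xz]].
    by rewrite eq_sym adj_neq //=; apply: contraNneq wz => <-.
  apply: contraNT xz => wx; apply/eqP/(card_le1_eqP NC); rewrite !inE negb_or ?xw ?zw //.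
have [_ [p [_ pP _]]] := bfs_parent w Gc.
have {p pP} [c zc] : exists c, z -- c by exists (p z); exact: pP.
have wc : w -- c.
  rewrite wadj [c == z]eq_sym (adj_neq zc) andbT.
  by apply: contraNneq wz => <-; rewrite adj_sym.
(* Any neighbour of [z] is also one of [w], and [w] and [z] have at most one common neighbour: [z]
   is pendant at [c]. *)
have zadj x : (z -- x) = (x == c).
  apply/idP/eqP => [zx|-> //]; apply: (@C4_free_codeg G w z) => //.
    by rewrite eq_sym.
  rewrite wadj [x == z]eq_sym (adj_neq zx) andbT.
  by apply: contraNneq wz => <-; rewrite adj_sym.
have [|a [b [wa wb ab abP]]] := tri (fun v => if v == z then c else w).
  have pw x y : x -- y -> ~~ (w -- x) -> (x != w) && (y == if x == z then c else w) ||
      (y != w) && (x == if y == z then c else w).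
    move=> xy; rewrite wadj negb_and !negbK => /orP[]/eqP E.
      by move: xy; rewrite E wadj => /andP[-> /negbTE ->]; rewrite !eqxx orbT.
    by rewrite E eqxx zw -zadj -E xy.
  move=> x y xy; rewrite negb_and => /orP[] nw; first exact: pw.
  by rewrite orbC pw // adj_sym.
have {wz} wz : (z == w) = false by exact: negbTE.
have [aw bw cw] : [/\ (a == w) = false, (b == w) = false & (c == w) = false].
  by split; apply/negbTE; rewrite eq_sym adj_neq.
have [az bz] : (a == z) = false /\ (b == z) = false.
  by move: wa wb; rewrite !wadj => /andP[_ /negbTE->] /andP[_ /negbTE->].
have adjE x y : (x -- y) = (x != y) && [|| (x == w) && (y != z),
    (y == w) && (x != z), (x == z) && (y == c), (y == z) && (x == c),
    (x == a) && (y == b) | (x == b) && (y == a)].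
  have [->|xy] := eqVneq x y; first by rewrite adj_irr.
  have simp := (eq_sym w, wz, aw, bw, cw, eq_sym z, az, bz, andbF, orbF, andbT).
  have [xw|xw] := eqVneq x w.
    have yw : (y == w) = false by rewrite -xw eq_sym; exact: negbTE.
    by rewrite xw wadj yw !simp.
  have [yw|yw] := eqVneq y w; first by rewrite yw adj_sym wadj xw !simp.
  have [xz|xz] := eqVneq x z.
    have yz : (y == z) = false by rewrite -xz eq_sym; exact: negbTE.
    by rewrite xz zadj yz !simp.
  have [yz|yz] := eqVneq y z; first by rewrite yz adj_sym zadj !simp.
  by rewrite abP ?wadj ?xw ?yw.
have sG : uniq [:: w; a; b; z] by rewrite /= !inE ![w == _]eq_sym aw bw wz az bz (negbTE ab).
(* The position of [c] decides: on the triangle it gives [G2], with [a] and [b] exchanged if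
   [c = b]; off the triangle it gives [G3]. *)
have [ca|ca] := eqVneq c a.
  constructor 2; have [f fB fE] := numbering Gn sG.
  apply: (isomorphic_graph_of fB) => x y /=.
  rewrite adjE ca !(fE 0) // !(fE 1) // !(fE 2) // !(fE 3) //=; congr (_ && _).
  by do !case: (_ == _).
have [cb|cb] := eqVneq c b.
  constructor 2; have sG' : uniq [:: w; b; a; z].
    by rewrite /= !inE ![w == _]eq_sym aw bw wz az bz [b == a]eq_sym (negbTE ab).
  have [f fB fE] := numbering Gn sG'.
  apply: (isomorphic_graph_of fB) => x y /=.
  rewrite adjE cb !(fE 0) // !(fE 1) // !(fE 2) // !(fE 3) //=; congr (_ && _).
  by do !case: (_ == _).
constructor 3; have sG' : uniq [:: w; a; b; c; z].
  have cz : (c == z) = false by rewrite eq_sym; apply/negbTE/adj_neq.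
  move: sG; rewrite /= !inE ![w == _]eq_sym aw bw cw wz az bz (negbTE ab).
  by rewrite ![_ == c]eq_sym (negbTE ca) (negbTE cb) cz.
have [f fB fE] := numbering Gn sG'.
apply: (isomorphic_graph_of fB) => x y /=.
rewrite adjE !(fE 0) // !(fE 1) // !(fE 2) // !(fE 3) // !(fE 4) //=; congr (_ && _).
by do !case: (_ == _).
Qed.

(** * The signless Laplacian *)

Local Open Scope ring_scope.

(** Over the complex numbers a unitary [P] diagonalizes [A], and in the coordinates [v] the form is
    the sum of the [sp 0 i], weighted by the squared moduli of the entries of [v]. *)
Lemma rayleigh_le (R : rcfType) (n : nat) (A : 'M[R]_n) (t : R) (x : 'rV[R]_n) :
  A^T = A -> (forall a, eigenvalue A a -> a <= t) ->
  (x *m A *m x^T) 0 0 <= t * (x *m x^T) 0 0.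
Proof.
move=> symA let_t; pose toC := real_complex R; pose B := map_mx toC A.
have BS : B \is hermsymmx.
  apply: realsym_hermsym.
    rewrite is_hermitianmxE expr0 scale1r map_mx_id //.
    by apply/eqP/matrixP => i j; rewrite !mxE -[in RHS]symA mxE.
  by apply/mxOverP => i j; rewrite mxE complex_real.
have BE := orthomx_spectralP (hermitian_normalmx BS).
have /mxOverP spR := hermitian_spectral_diag_real BS.
set P := spectralmx B in BE; set sp := spectral_diag B in BE spR.
have PU : P \is unitarymx by exact: spectral_unitarymx.
have Pu : P \in unitmx by exact: unitarymx_unit.
have PB : P *m B = diag_mx sp *m P by rewrite BE !mulmxA mulmxV // mul1mx.
(* Row [i] of [P] is a complex eigenvector for the real number [sp 0 i], which is therefore an
   eigenvalue of [A] itself. *)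
have sp_le i : sp 0 i <= toC t.
  have /complex_realP[r spE] := spR 0 i.
  rewrite spE lecR; apply: let_t.
  rewrite -(eigenvalue_map toC) -[_ r]spE; apply/eigenvalueP; exists (row i P).
    by rewrite -row_mul PB row_mul row_diag_mx -scalemxAl -rowE.
  rewrite rowE; apply: contraTneq (oner_neq0 R) => /(congr1 (mulmxr (invmx P))).
  by rewrite /= mulmxK // mul0mx => /matrixP/(_ 0 i) /eqP; rewrite !mxE !eqxx oner_eq0.
pose w := map_mx toC x; pose v := w *m invmx P.
have wT : w^T = (w ^t*)%sesqui.
  by apply/matrixP => i j; rewrite !mxE; apply/esym/conjc_real.
have vT : P *m (w ^t*)%sesqui = (v ^t*)%sesqui.
  by rewrite /v invmx_unitary // trmx_mul map_mxM trmxCK.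
rewrite -lecR rmorphM /=.
have -> : ((x *m A *m x^T) 0 0)%:C%C = (v *m diag_mx sp *m (v ^t*)%sesqui) 0 0.
  have -> : ((x *m A *m x^T) 0 0)%:C%C = map_mx toC (x *m A *m x^T) 0 0 by rewrite [RHS]mxE.
  by rewrite !map_mxM -map_trmx /= -/w wT -/B BE -vT /v !mulmxA.
have -> : ((x *m x^T) 0 0)%:C%C = (v *m (v ^t*)%sesqui) 0 0.
  have -> : ((x *m x^T) 0 0)%:C%C = map_mx toC (x *m x^T) 0 0 by rewrite [RHS]mxE.
  by rewrite map_mxM -map_trmx -/w wT -vT /v mulmxA mulmxKV.
rewrite ![(_ *m (v ^t*)%sesqui) 0 0]mxE mulr_sumr; apply: ler_sum => i _.
rewrite mul_mx_diag !mxE -/v mulrAC mulrC mulrA -mulrA.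
exact: ler_wpM2r (mul_conjC_ge0 _) _ _ (sp_le i).
Qed.

(** The product of the signless Laplacian with [x], indexed by vertices instead of through
    [enum_val]. *)
Definition signless (R : realType) (G : sgraph) (x : G -> R) (u : G) : R :=
  \sum_(v | u -- v) (x u + x v).

Lemma signless_mx (R : realType) (G : sgraph) (x : G -> R) (i : 'I_#|G|) :
  ((\row_j x (enum_val j)) *m signless_laplacian R G) 0 i = signless x (enum_val i).
Proof.
rewrite /signless big_split /= sumr_const mxE /signless_laplacian.
under [LHS]eq_bigr do rewrite !mxE mulrDr.
rewrite big_split /=; congr (_ + _).
  rewrite (bigD1 i) //= eqxx mulr1n big1 => [|j /negbTE ->]; last by rewrite mulr0.
  by rewrite addr0 mulr_natr /deg; congr (_ *+ _); apply: eq_card => v; rewrite inE.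
rewrite [RHS](reindex _ (onW_bij _ (enum_val_bij _))) [RHS]big_mkcond /=.
by apply: eq_bigr => j _; rewrite adj_sym mulr_natr; case: adj; rewrite ?mulr0n.
Qed.

Lemma signless_eigenP (R : realType) (G : sgraph) (t : R) :
  eigenvalue (signless_laplacian R G) t <->
  exists2 x : G -> R, (exists u, x u != 0) & forall u, signless x u = t * x u.
Proof.
split=> [/eigenvalueP[v vQ v0]|[x [u xu0] xQ]].
  have vE : v = \row_j v 0 (enum_rank (enum_val j)).
    by apply/rowP => j; rewrite mxE enum_valK.
  exists (fun u => v 0 (enum_rank u)).
    by have /rV0Pn[i vi0] := v0; exists (enum_val i); rewrite enum_valK.
  move=> u; rewrite -{1}[u]enum_rankK -(signless_mx (fun u => v 0 (enum_rank u))).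
  by rewrite -vE vQ mxE.
apply/eigenvalueP; exists (\row_j x (enum_val j)).
  by apply/rowP => i; rewrite signless_mx xQ !mxE.
by apply/rV0Pn; exists (enum_rank u); rewrite mxE enum_rankK.
Qed.

Lemma signless_le_q (R : realType) (G : sgraph) (x : G -> R) :
  (0 < #|G|)%N -> \sum_u x u * signless x u <= q R G * \sum_u x u ^+ 2.
Proof.
move=> /(q_largest R)[_ qmax].
have := rayleigh_le (\row_j x (enum_val j)) (signless_laplacian_sym R G) qmax.
rewrite !mxE !(reindex _ (onW_bij _ (enum_val_bij G))) /=.
under eq_bigr do rewrite signless_mx !mxE mulrC.
by under [in leRHS]eq_bigr do rewrite !mxE -expr2.
Qed.

(* The comparison of the moduli of an eigenvector with a positive
   subinvariant vector takes place at a vertex maximizing their ratio. *)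
Lemma q_le_positive (R : realType) (G : sgraph) (x : G -> R) (t : R) :
  (0 < #|G|)%N -> (forall u, 0 < x u) -> (forall u, signless x u <= t * x u) ->
  q R G <= t.
Proof.
move=> /(q_largest R)[/signless_eigenP[y [u0 yu0] yQ] _] x0 xQ.
have [u _ umax] := @Order.TotalTheory.arg_maxP _ R G u0 predT (fun u => `|y u| / x u) isT.
set r := `|y u| / x u in umax; have yr v : `|y v| <= r * x v.
  by rewrite -ler_pdivrMr //; exact: umax.
have yu : `|y u| = r * x u by rewrite divfK // gt_eqF.
have r0 : 0 < r by rewrite (lt_le_trans _ (umax u0 isT)) // divr_gt0 ?normr_gt0.
(* At the maximizing [u] the triangle inequality bounds the left side by [r * signless x u], hence
   by [r * (t * x u)]. *)
have : `|q R G * y u| <= t * `|y u|.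
  rewrite -yQ yu mulrCA; apply: le_trans (ler_norm_sum _ _ _) _.
  apply: le_trans (ler_wpM2l (ltW r0) (xQ u)); rewrite mulr_sumr.
  apply: ler_sum => v _; rewrite mulrDr; apply: le_trans (ler_normD _ _) _.
  exact: lerD.
rewrite normrM ler_pM2r; last by rewrite yu mulr_gt0.
exact/le_trans/ler_norm.
Qed.

(** This is the bound on [d_u + m_u] multiplied by [3 * deg u]. For [n > 6], degrees up to 2 use
    [S2] and larger ones use [S1]. *)
Lemma deg_le_weight (G : sgraph) (n : nat) (u : G) : (6 <= n)%N -> U n G ->
  (forall w : G, (deg w < n - 2)%N) ->
  (3 * (deg u * deg u + \sum_(v | u -- v) deg v) <=
     (if n == 6 then 16 else 3 * (n - 1)) * deg u)%N.
Proof.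
move=> n6 GU Dn; have S1 := sum_deg_nbhd u GU.
have S2 : (\sum_(v | u -- v) deg v <= deg u * (n - 3))%N.
  rewrite /deg -sum_nat_const big_mkcond [leqRHS]big_mkcond; apply: leq_sum => v _.
  by rewrite inE; case: adj => //; have := Dn v; rewrite /deg; lia.
have := Dn u; move: (deg u) (\sum_(v | _) _)%N S1 S2 => d S S1 S2 dn.
case: eqP => [n6E|n6E]; first by subst n; case: d S2 dn => [|[|[|[|[]]]]]; lia.
case: d S1 S2 dn => [|[|[|d]]] S1 S2 dn; [lia|lia|lia|].
suff : (d.+3 * d.+3 + n.+1 <= (n - 1) * d.+3)%N by lia.
(* In terms of [d] and [e] the claim becomes [1 <= d * e + d + 2 * e], which fails only for
   [d = e = 0], that is, for [n = 6]. *)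
have [e nE] : exists e, n = (d + e + 6)%N by exists (n - d - 6)%N; lia.
subst n; have -> : (d + e + 6 - 1 = d + e + 5)%N by lia.
by nia.
Qed.

(* The value at [n = 6] exceeds [n - 1]: a vertex of degree 3 on the triangle
   can have neighbours whose degrees sum to 7, so that [d_u + m_u = 16/3]. *)
Definition weight_bound (R : realType) (n : nat) : R :=
  if n == 6 then 16 / 3 else (n - 1)%:R.

Lemma q_le_weight_bound (R : realType) (G : sgraph) (n : nat) : (6 <= n)%N -> U n G ->
  (forall w : G, (deg w < n - 2)%N) -> q R G <= weight_bound R n.
Proof.
move=> n6 GU Dn; have [[Gc Gn _] _] := GU.
apply: (@q_le_positive R G (fun u => (deg u)%:R)) => [|u|u]; first by case: Gc.
  (* The degree of [u] is positive because [u] has a parent in a tree rooted at another vertex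
     [v]. *)
  rewrite ltr0n; have [v vu] : exists v, v != u.
    have /card_gt1P[x [y [_ _ xy]]] : (1 < #|[set: G]|)%N by rewrite cardsT Gn; lia.
    move: xy; have [->|xu _] := eqVneq x u; last by exists x.
    by rewrite eq_sym; exists y.
  have [_ [p [_ pP _]]] := bfs_parent v Gc.
  by apply/card_gt0P; exists (p u); rewrite inE pP // eq_sym.
have := deg_le_weight u n6 GU Dn; rewrite -(ler_nat R).
rewrite /signless big_split /= sumr_const -natr_sum.
have -> : #|[pred v | u -- v]| = deg u by apply: eq_card => v; rewrite inE.
rewrite /weight_bound; case: eqP => _; rewrite !natrM natrD natrM -mulr_natr; lra.
Qed.

(** * Comparison of [G1], [G2] and [G3] *)

(** The hypothesis says that [r] lists each edge in one direction only, so each edge contributes a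
    single square. *)
Lemma signless_graph_of (R : realType) (n : nat) (r : rel 'I_n) (x : 'I_n -> R) :
  (forall i j, i != j -> r i j -> ~~ r j i) ->
  \sum_i x i * @signless R (graph_of r) x i =
  \sum_i \sum_(j | (i != j) && r i j) (x i + x j) ^+ 2.
Proof.
move=> rN; have -> : \sum_i x i * @signless R (graph_of r) x i =
    \sum_i \sum_(j | (i != j) && r i j) x i * (x i + x j) +
    \sum_i \sum_(j | (i != j) && r j i) x i * (x i + x j).
  rewrite -big_split; apply: eq_bigr => i _ /=; rewrite /signless mulr_sumr.
  rewrite [LHS]big_mkcond [X in X + _]big_mkcond [X in _ + X]big_mkcond -big_split.
  apply: eq_bigr => j _ /=; rewrite /graph_of_adj /=.
  have [//|ij] := eqVneq i j; first by rewrite addr0.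
  have := rN i j ij; case: (r i j) => [/(_ isT)/negbTE->|_] /=; rewrite ?addr0 //.
  by case: (r j i); rewrite add0r.
rewrite [X in _ + X](exchange_big_dep xpredT) //= -big_split /=.
apply: eq_bigr => i _.
under [X in _ + X]eq_bigl do rewrite eq_sym.
by rewrite -big_split /=; apply: eq_bigr => j _; ring.
Qed.

Lemma signless_nbrs (R : realType) (G : sgraph) (x : G -> R) (u : G) (s : seq G) :
  uniq s -> (forall v, (u -- v) = (v \in s)) ->
  signless x u = \sum_(v <- s) (x u + x v).
Proof. by move=> us sE; rewrite big_uniq //; apply: eq_bigl => v; rewrite sE. Qed.

(** The star at [o0] stays a single sum, so that the common part of two such forms cancels when
    graphs are compared. *)
Lemma G1_form (R : realType) (n : nat) (o0 o1 o2 : 'I_n) (x : 'I_n -> R) :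
  o0 = 0%N :> nat -> o1 = 1%N :> nat -> o2 = 2%N :> nat ->
  \sum_i x i * @signless R (G1 n) x i =
  \sum_(j | j != o0) (x o0 + x j) ^+ 2 + (x o1 + x o2) ^+ 2.
Proof.
move=> h0 h1 h2; rewrite signless_graph_of; last first.
  by move=> i j /=; rewrite -val_eqE /=; lia.
rewrite (bigD1 o0) //=; congr (_ + _).
  by apply: eq_bigl => j; rewrite -!val_eqE /= h0; lia.
rewrite (bigD1 o1) /=; last by rewrite -val_eqE /= h0 h1.
rewrite (big_pred1 o2) => [|j]; last by rewrite /= -!val_eqE /= h1 h2; lia.
rewrite big1 ?addr0 // => i /andP[i0 i1]; apply: big_pred0 => j.
by move: i0 i1; rewrite -!val_eqE /= h0 h1; lia.
Qed.

Lemma G2_form (R : realType) (n : nat) (o0 o1 o2 o3 : 'I_n) (x : 'I_n -> R) :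
  o0 = 0%N :> nat -> o1 = 1%N :> nat -> o2 = 2%N :> nat -> o3 = 3%N :> nat ->
  \sum_i x i * @signless R (G2 n) x i =
  \sum_(j | (j != o0) && (j != o3)) (x o0 + x j) ^+ 2 +
  (x o1 + x o2) ^+ 2 + (x o1 + x o3) ^+ 2.
Proof.
move=> h0 h1 h2 h3; rewrite signless_graph_of; last first.
  by move=> i j /=; rewrite -val_eqE /=; lia.
rewrite (bigD1 o0) //= -addrA; congr (_ + _).
  by apply: eq_bigl => j; rewrite -!val_eqE /= h0 h3; lia.
rewrite (bigD1 o1) /=; last by rewrite -val_eqE /= h0 h1.
rewrite (bigD1 o2) /=; last by rewrite -val_eqE /= h1 h2.
rewrite (big_pred1 o3) => [|j]; last by rewrite /= -!val_eqE /= h1 h2 h3; lia.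
rewrite big1 ?addr0 // => i /andP[i0 i1]; apply: big_pred0 => j.
by move: i0 i1; rewrite -!val_eqE /= h0 h1; lia.
Qed.

Lemma G3_form (R : realType) (n : nat) (o0 o1 o2 o3 o4 : 'I_n) (x : 'I_n -> R) :
  o0 = 0%N :> nat -> o1 = 1%N :> nat -> o2 = 2%N :> nat -> o3 = 3%N :> nat ->
  o4 = 4%N :> nat ->
  \sum_i x i * @signless R (G3 n) x i =
  \sum_(j | (j != o0) && (j != o4)) (x o0 + x j) ^+ 2 +
  (x o1 + x o2) ^+ 2 + (x o3 + x o4) ^+ 2.
Proof.
move=> h0 h1 h2 h3 h4; rewrite signless_graph_of; last first.
  by move=> i j /=; rewrite -val_eqE /=; lia.
rewrite (bigD1 o0) //= -addrA; congr (_ + _).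
  by apply: eq_bigl => j; rewrite -!val_eqE /= h0 h4; lia.
rewrite (bigD1 o1) /=; last by rewrite -val_eqE /= h0 h1.
rewrite (big_pred1 o2) => [|j]; last by rewrite /= -!val_eqE /= h1 h2; lia.
rewrite (bigD1 o3) /=; last by rewrite -!val_eqE /= h0 h1 h3.
rewrite (big_pred1 o4) => [|j]; last by rewrite /= -!val_eqE /= h3 h4; lia.
rewrite big1 ?addr0 // => i /andP[/andP[i0 i1] i3]; apply: big_pred0 => j.
by move: i0 i1 i3; rewrite -!val_eqE /= h0 h1 h3; lia.
Qed.

Lemma ordinal_of_nat (n m : nat) : (m <= n)%N ->
  forall k, (k < m)%N -> {i : 'I_n | i = k :> nat}.
Proof. by move=> mn k km; exists (Ordinal (leq_trans km mn)). Qed.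

Lemma G3_test_vector (R : realType) (n : nat) (w a c p z : R) :
  2 * (w + a) ^+ 2 + 4 * a ^+ 2 + (w + c) ^+ 2 + n%:R * (w + p) ^+ 2 + (c + z) ^+ 2
  <= q R (G3 n.+4.+1) *
       (w ^+ 2 + 2 * a ^+ 2 + c ^+ 2 + n%:R * p ^+ 2 + z ^+ 2).
Proof.
(* The default [p] of [nth] is the value at the pendant vertices [5, 6, ...]. *)
pose X i := nth p [:: w; a; a; c; z] i.
have card_gt0 : (0 < #|G3 n.+4.+1|)%N by rewrite card_ord.
have := @signless_le_q R (G3 n.+4.+1) (fun i : 'I_n.+4.+1 => X i) card_gt0.
have o := @ordinal_of_nat n.+4.+1 5 isT.
have [o0 h0] := o 0%N isT; have [o1 h1] := o 1%N isT; have [o2 h2] := o 2%N isT.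
have [o3 h3] := o 3%N isT; have [o4 h4] := o 4%N isT.
rewrite (G3_form _ h0 h1 h2 h3 h4) !h0 !h1 !h2 !h3 !h4 big_mkcond /=.
have -> : \sum_(i < n.+4.+1) (if (i != o0) && (i != o4) then (X 0%N + X i) ^+ 2 else 0)
    = \sum_(i < n.+4.+1) (if (i != 0 :> nat) && (i != 4 :> nat) then (w + X i) ^+ 2 else 0).
  by apply: eq_bigr => i _; rewrite -!val_eqE /= h0 h4.
rewrite !big_ord_recl /X /=; under [in leLHS]eq_bigr do rewrite nth_nil.
under [in leRHS]eq_bigr do rewrite nth_nil.
by rewrite !sumr_const !card_ord -[_ *+ n]mulr_natl -[p ^+ 2 *+ n]mulr_natl; lra.
Qed.


Lemma weight_bound_lt_q_G3 (R : realType) (n : nat) : (6 <= n)%N ->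
  weight_bound R n < q R (G3 n).
Proof.
case: n => [|[|[|[|[|[|n]]]]]] // _; rewrite /weight_bound; case: eqP => [[->]|n0].
  (* The Rayleigh quotient is [1184 / 220], just above [16 / 3]. *)
  by have := @G3_test_vector R 1 12 5 4 3 1; lra.
(* This is the eigenvector, for [n + 5], of the star with [n + 4] leaves, extended by 0 at [z]. The
   edges [ab] and [cz] add [4 + 1] to the form, so the quotient exceeds [n + 5]. *)
have := @G3_test_vector R n.+1 n.+4%:R 1 1 1 0.
have -> : n.+4%:R = n%:R + 4 :> R by rewrite -addn4 natrD.
have -> : n.+1%:R = n%:R + 1 :> R by rewrite -addn1 natrD.
rewrite (_ : n.+1.+4.+1 - 1 = n + 5)%N; last by lia.
rewrite natrD; have := ler0n R n; nra.
Qed.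

Lemma weight_bound_ge5 (R : realType) (n : nat) : (6 <= n)%N -> 5 <= weight_bound R n.
Proof.
by move=> n6; rewrite /weight_bound; case: eqP => _; [lra|rewrite ler_nat; lia].
Qed.

Lemma test_vector_lt_q (R : realType) (G : sgraph) (x : G -> R) (t : R) : (0 < #|G|)%N ->
  t * \sum_u x u ^+ 2 < \sum_u x u * signless x u -> t < q R G.
Proof.
move=> G0 /lt_le_trans/(_ (signless_le_q x G0)) lt_tq.
rewrite ltNge; apply/negP => le_qt; move: lt_tq; rewrite ltNge ler_wpM2r //.
by apply: sumr_ge0 => u _; exact: sqr_ge0.
Qed.

(** Eigenvector entries will be multiples of one entry [y] of unknown sign, after clearing a
    denominator [k]; squares allow comparing them. *)
Lemma sqr_lt_scale (R : realFieldType) (k a b y u v : R) :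
  0 < k -> y != 0 -> 0 <= a -> a < b -> k * u = a * y -> k * v = b * y ->
  u ^+ 2 < v ^+ 2.
Proof.
move=> k0 y0 a0 ab uE vE; rewrite -(ltr_pM2l (exprn_gt0 2 k0)) -!exprMn uE vE !exprMn.
rewrite ltr_pM2r ?ltr_pXn2r ?nnegrE //; first exact: le_trans (ltW ab).
by rewrite exprn_even_gt0.
Qed.

(* Moving the edge [cz] of [G3] to [az] turns [G3] into [G2]. *)
Lemma q_G3_lt_G2 (R : realType) (n : nat) : (6 <= n)%N ->
  5 < q R (G3 n) -> q R (G3 n) < q R (G2 n).
Proof.
move=> n6; have card_gt0 r : (0 < #|@graph_of 'I_n r|)%N by rewrite card_ord; lia.
have [/signless_eigenP[y [u yu] yQ] _] := q_largest R (card_gt0 _ : (0 < #|G3 n|)%N).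
move: yQ; set t := q R (G3 n) => yQ t5.
have o := ordinal_of_nat n6.
have [o0 h0] := o 0%N isT; have [o1 h1] := o 1%N isT; have [o2 h2] := o 2%N isT.
have [o3 h3] := o 3%N isT; have [o4 h4] := o 4%N isT.
have nbrs v s : uniq s -> (forall i : G3 n, (v -- i) = (i \in s)) ->
    \sum_(i <- s) (y v + y i) = t * y v.
  by move=> us sE; rewrite -yQ (signless_nbrs _ us sE).
have E1 : (y o1 + y o0) + (y o1 + y o2) = t * y o1.
  rewrite -(nbrs _ [:: o0; o2]); first by rewrite !big_cons big_nil addr0.
    by rewrite /= inE -val_eqE /= h0 h2.
  by move=> i; rewrite !inE /= /graph_of_adj /= -!val_eqE /= h0 h1 h2; lia.
have E2 : (y o2 + y o0) + (y o2 + y o1) = t * y o2.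
  rewrite -(nbrs _ [:: o0; o1]); first by rewrite !big_cons big_nil addr0.
    by rewrite /= inE -val_eqE /= h0 h1.
  by move=> i; rewrite !inE /= /graph_of_adj /= -!val_eqE /= h0 h1 h2; lia.
have E3 : (y o3 + y o0) + (y o3 + y o4) = t * y o3.
  rewrite -(nbrs _ [:: o0; o4]); first by rewrite !big_cons big_nil addr0.
    by rewrite /= inE -val_eqE /= h0 h4.
  by move=> i; rewrite !inE /= /graph_of_adj /= -!val_eqE /= h0 h3 h4; lia.
have E4 : y o4 + y o3 = t * y o4.
  rewrite -(nbrs _ [:: o3]) //; first by rewrite !big_cons big_nil addr0.
  by move=> i; rewrite !inE /= /graph_of_adj /= -!val_eqE /= h3 h4; lia.
have Ei (i : 'I_n) : (4 < i)%N -> y i + y o0 = t * y i.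
  move=> i4; rewrite -(nbrs _ [:: o0]) //; first by rewrite !big_cons big_nil addr0.
  by move=> j; rewrite !inE /= /graph_of_adj /= -!val_eqE /= h0; lia.
have y12 : y o1 = y o2.
  by apply: (@mulfI _ (t - 1)); [lra|nra].
have y10 : (t - 3) * y o1 = y o0 by rewrite -y12 in E1; lra.
have y34 : y o3 = (t - 1) * y o4 by lra.
have y04 : y o0 = (t ^+ 2 - 3 * t + 1) * y o4 by move: E3; rewrite y34; nra.
(* All entries are determined by [y o4], so its vanishing would kill the eigenvector. *)
have y4_neq0 : y o4 != 0.
  apply: contraNneq yu => y4; have y3 : y o3 = 0 by rewrite y34 y4 mulr0.
  have y0 : y o0 = 0 by rewrite y04 y4 mulr0.
  have y1 : y o1 = 0.
    by move/eqP: y10; rewrite y0 mulf_eq0 => /orP[/eqP|/eqP]; lra.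
  have [u4|u4] := ltnP 4 u; first by apply/eqP; have := Ei u u4; rewrite y0; nra.
  have [i ui yi] : exists2 i : 'I_n, u = i :> nat & y i = 0.
    case: (u : 'I_n) u4 => [[|[|[|[|[|//]]]]] /= _] _;
      [exists o0|exists o1|exists o2|exists o3|exists o4] => //.
    by rewrite -y12.
  by rewrite (val_inj ui : u = i) yi.
(* The two coefficients of [y o4] differ by [t - 2]. *)
have lt34 : (y o3 + y o4) ^+ 2 < (y o1 + y o4) ^+ 2.
  apply: (@sqr_lt_scale _ (t - 3) ((t - 3) * t) (t ^+ 2 - 2 * t - 2) (y o4)) => //;
    [lra|nra|lra|by rewrite y34; ring|by rewrite mulrDr y10 y04; ring].
(* The moved pendant vertex has label 4 in [G3] but label 3 in [G2]; [s] relabels the eigenvector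
   accordingly. *)
pose s := tperm o3 o4.
have sK i : i != o3 -> i != o4 -> s i = i by move=> i3 i4; rewrite tpermD // eq_sym.
have s0 : s o0 = o0 by rewrite sK // -val_eqE /= h0 ?h3 ?h4.
have s1 : s o1 = o1 by rewrite sK // -val_eqE /= h1 ?h3 ?h4.
have s2 : s o2 = o2 by rewrite sK // -val_eqE /= h2 ?h3 ?h4.
pose x (i : 'I_n) := y (s i).
apply: (@test_vector_lt_q R (G2 n) x); first exact: card_gt0.
rewrite (G2_form x h0 h1 h2 h3) /x s0 s1 s2 tpermL.
have -> : \sum_i y (s i) ^+ 2 = \sum_i y i ^+ 2 by rewrite [RHS](reindex_inj (@perm_inj _ s)).
have <- : \sum_i y i * signless y i = t * \sum_i y i ^+ 2.
  by rewrite mulr_sumr; apply: eq_bigr => i _; rewrite yQ; ring.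
rewrite (G3_form _ h0 h1 h2 h3 h4) (reindex_inj (@perm_inj _ s)) /=.
rewrite (eq_bigl (fun i => (i != o0) && (i != o3))) => [|i]; last first.
  by rewrite -(inj_eq (@perm_inj _ s) i o0) -(inj_eq (@perm_inj _ s) i o3) s0 tpermL.
by rewrite ltrD2l.
Qed.

(* Moving the edge [az] of [G2] to [wz] turns [G2] into [G1]. *)
Lemma q_G2_lt_G1 (R : realType) (n : nat) : (6 <= n)%N ->
  5 < q R (G2 n) -> q R (G2 n) < q R (G1 n).
Proof.
move=> n6; have card_gt0 r : (0 < #|@graph_of 'I_n r|)%N by rewrite card_ord; lia.
have [/signless_eigenP[y [u yu] yQ] _] := q_largest R (card_gt0 _ : (0 < #|G2 n|)%N).
move: yQ; set t := q R (G2 n) => yQ t5.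
have o := ordinal_of_nat n6.
have [o0 h0] := o 0%N isT; have [o1 h1] := o 1%N isT; have [o2 h2] := o 2%N isT.
have [o3 h3] := o 3%N isT.
have nbrs v s : uniq s -> (forall i : G2 n, (v -- i) = (i \in s)) ->
    \sum_(i <- s) (y v + y i) = t * y v.
  by move=> us sE; rewrite -yQ (signless_nbrs _ us sE).
have E1 : (y o1 + y o0) + ((y o1 + y o2) + (y o1 + y o3)) = t * y o1.
  rewrite -(nbrs _ [:: o0; o2; o3]); first by rewrite !big_cons big_nil addr0.
    by rewrite /= !inE -!val_eqE /= h0 h2 h3.
  by move=> i; rewrite !inE /= /graph_of_adj /= -!val_eqE /= h0 h1 h2 h3; lia.
have E2 : (y o2 + y o0) + (y o2 + y o1) = t * y o2.
  rewrite -(nbrs _ [:: o0; o1]); first by rewrite !big_cons big_nil addr0.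
    by rewrite /= inE -val_eqE /= h0 h1.
  by move=> i; rewrite !inE /= /graph_of_adj /= -!val_eqE /= h0 h1 h2; lia.
have E3 : y o3 + y o1 = t * y o3.
  rewrite -(nbrs _ [:: o1]) //; first by rewrite !big_cons big_nil addr0.
  by move=> i; rewrite !inE /= /graph_of_adj /= -!val_eqE /= h1 h3; lia.
have Ei (i : 'I_n) : (3 < i)%N -> y i + y o0 = t * y i.
  move=> i3; rewrite -(nbrs _ [:: o0]) //; first by rewrite !big_cons big_nil addr0.
  by move=> j; rewrite !inE /= /graph_of_adj /= -!val_eqE /= h0; lia.
have y13 : y o1 = (t - 1) * y o3 by lra.
have y23 : (t - 1) * y o2 = (t ^+ 2 - 3 * t + 1) * y o3.
  by move: E1 E2; rewrite y13; lra.
have y03 : y o0 = (t ^+ 2 - 4 * t + 2) * y o3 - y o2 by move: E1; rewrite y13; lra.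
have y3_neq0 : y o3 != 0.
  apply: contraNneq yu => y3; have y1 : y o1 = 0 by rewrite y13 y3 mulr0.
  have y2 : y o2 = 0.
    by move/eqP: y23; rewrite y3 mulr0 mulf_eq0 => /orP[/eqP|/eqP]; lra.
  have y0 : y o0 = 0 by rewrite y03 y3 y2; ring.
  have [u3|u3] := ltnP 3 u; first by apply/eqP; have := Ei u u3; rewrite y0; nra.
  have [i ui yi] : exists2 i : 'I_n, u = i :> nat & y i = 0.
    by case: (u : 'I_n) u3 => [[|[|[|[|//]]]] /= _] _;
      [exists o0|exists o1|exists o2|exists o3].
  by rewrite (val_inj ui : u = i) yi.
have e_gt0 : 0 < t - 5 by lra.
have lt13 : (y o1 + y o3) ^+ 2 < (y o0 + y o3) ^+ 2.
  apply: (@sqr_lt_scale _ (t - 1) ((t - 1) * t)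
    (t ^+ 3 - 6 * t ^+ 2 + 10 * t - 4) (y o3)) => //;
    [lra|nra| |by rewrite y13; ring|by rewrite y03 !mulrDr mulrN y23; ring].
  (* With [e = t - 5] the difference of the coefficients is [e ^+ 3 + 8 * e ^+ 2 + 16 * e + 1]. *)
  by have := exprn_gt0 2 e_gt0; have := exprn_gt0 3 e_gt0; lra.
apply: (@test_vector_lt_q R (G1 n) y); first exact: card_gt0.
have -> : t * \sum_u y u ^+ 2 = \sum_i y i * @signless R (G2 n) y i.
  by rewrite mulr_sumr; apply: eq_bigr => i _; rewrite yQ; ring.
rewrite (G2_form _ h0 h1 h2 h3) (G1_form _ h0 h1 h2) [in ltRHS](bigD1 o3) /=; last first.
  by rewrite -val_eqE /= h0 h3.
by rewrite [X in _ < X + _]addrC [ltRHS]addrAC ltrD2l.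
Qed.

Theorem theorem3p2 (R : realType) (n : nat) (hn : (6 <= n)%N) (G : sgraph) :
  U n G ->
  ~ isomorphic G (G1 n) -> ~ isomorphic G (G2 n) -> ~ isomorphic G (G3 n) ->
  [/\ q R G < q R (G3 n), q R (G3 n) < q R (G2 n) & q R (G2 n) < q R (G1 n)].
Proof.
move=> GU N1 N2 N3.
have q3 := weight_bound_lt_q_G3 R hn.
have q3_gt5 : 5 < q R (G3 n) := le_lt_trans (weight_bound_ge5 R hn) q3.
have q32 := q_G3_lt_G2 hn q3_gt5.
split; [|exact: q32|exact: q_G2_lt_G1 (lt_trans q3_gt5 q32)].
apply: le_lt_trans q3; apply: q_le_weight_bound => // w.
rewrite ltnNge; apply/negP => /(large_deg_isomorphic _ GU) [|//|//|//].
exact: leq_trans hn.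
Qed.
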